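(* Let $X$ and $Y$ be real normed linear spaces, let $1\le p<\infty$, and let $Z=X\oplus_p Y$. Let $H\subset X$ and $N\subset Y$ be nonempty bounded subsets. Then both $H$ is $M$-compact in $X$ and $N$ is $M$-compact in $Y$ if and only if $H\oplus_p N$ is $M$-compact in $X\oplus_p Y$.
   Context: $X\oplus_p Y$ denotes the vector space $X\times Y$ with the norm $\|(x,y)\|_p=(\|x\|^p+\|y\|^p)^{1/p}$. For $H\subseteq X$, $N\subseteq Y$, $H\oplus_p N$ denotes the subset $\{(h,n): h\in H,\ n\in N\}$ of $X\oplus_p Y$. For a nonempty bounded subset $G$ of a real normed linear space $E$ and $x\in E$, $\delta(x,G)=\sup\{\|x-e\|: e\in G\}$. A sequence $(x_n)$ in $G$ is a maximizing sequence in $G$ if there exists $x\in E$ such that $\|x_n-x\|\to\delta(x,G)$. The set $G$ is called $M$-compact if every maximizing sequence in $G$ has a subsequence converging (in norm) to an element of $G$. *)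

(* Defs.v *)
From HB Require Import structures.
From mathcomp Require Import all_boot all_order all_algebra.
From mathcomp Require Import all_classical all_reals all_analysis.
From mathcomp Require Import ring.

Set Implicit Arguments.
Unset Strict Implicit.
Unset Printing Implicit Defensive.

Import Order.TTheory GRing.Theory Num.Theory.
Import numFieldNormedType.Exports.

Local Open Scope classical_set_scope.
Local Open Scope ring_scope.

Section real_minkowski.
Context (R : realType) (p : R) (p1 : 1 <= p).
Implicit Types a b c d A B : R.

Let p_gt0 : 0 < p. Proof. exact: lt_le_trans p1. Qed.

Let p_neq0 : p != 0. Proof. by rewrite gt_eqF. Qed.

Let powR_convex_ratio A B a c : 0 < A -> 0 < B -> 0 <= a -> 0 <= c ->
  (a + c) `^ p / (A + B) `^ p <=
  A / (A + B) * (a `^ p / A `^ p) + B / (A + B) * (c `^ p / B `^ p).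
Proof.
move=> A0 B0 a0 c0; have S0 : 0 < A + B by exact: addr_gt0.
have divE u v : 0 <= u -> 0 < v -> u `^ p / v `^ p = (u / v) `^ p.
  move=> u0 v0; rewrite powRM ?invr_ge0 ?(ltW v0)//; congr (_ * _).
  by rewrite -[v^-1]powR_inv1 ?(ltW v0)// -powRrM mulN1r powRN.
have t0 : 0 <= A / (A + B) by rewrite divr_ge0 ?(ltW A0) ?(ltW S0).
have t1 : A / (A + B) <= 1 by rewrite ler_pdivrMr// mul1r lerDl (ltW B0).
have ge0 u v : 0 <= u -> 0 < v -> u / v \in (`[0, +oo[ : interval R).
  by move=> u0 v0; rewrite in_itv/= andbT divr_ge0 ?(ltW v0).
have cvx : (A / (A + B) * (a / A) + (1 - A / (A + B)) * (c / B)) `^ p <=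
    A / (A + B) * (a / A) `^ p + (1 - A / (A + B)) * (c / B) `^ p.
  apply: (convex_powR p1 (Itv01 t0 t1)); rewrite inE; exact: ge0.
have onemE : 1 - A / (A + B) = B / (A + B) by field; rewrite gt_eqF.
have argE : A / (A + B) * (a / A) + B / (A + B) * (c / B) = (a + c) / (A + B).
  by field; rewrite !gt_eqF.
by move: cvx; rewrite onemE argE !divE ?addr_ge0.
Qed.

Let powR2_root a b : 0 <= (a `^ p + b `^ p) `^ p^-1.
Proof. exact: powR_ge0. Qed.

Let powR2_rootK a b : (a `^ p + b `^ p) `^ p^-1 `^ p = a `^ p + b `^ p.
Proof. by rewrite -powRrM mulVf// powRr1// addr_ge0// powR_ge0. Qed.

Let powR2_root0 a b : (a `^ p + b `^ p) `^ p^-1 = 0 -> a = 0 /\ b = 0.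
Proof.
move=> r0; have := powR2_rootK a b; rewrite r0 powR0// => /esym/eqP.
rewrite paddr_eq0 ?powR_ge0//.
by move=> /andP[/eqP/powR_eq0_eq0-> /eqP/powR_eq0_eq0->].
Qed.

Lemma powR2_minkowski a b c d : 0 <= a -> 0 <= b -> 0 <= c -> 0 <= d ->
  ((a + c) `^ p + (b + d) `^ p) `^ p^-1 <=
  (a `^ p + b `^ p) `^ p^-1 + (c `^ p + d `^ p) `^ p^-1.
Proof.
move=> a0 b0 c0 d0.
have /orP[/eqP e|] := orbN ((a `^ p + b `^ p) `^ p^-1 == 0).
  by have [-> ->] := powR2_root0 e; rewrite !add0r lerDr powR_ge0.
have /orP[/eqP e|] := orbN ((c `^ p + d `^ p) `^ p^-1 == 0).
  by have [-> ->] := powR2_root0 e; rewrite !addr0 lerDl powR_ge0.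
move: (powR2_root a b) (powR2_root c d) (powR2_rootK a b) (powR2_rootK c d).
move: ((a `^ p + b `^ p) `^ p^-1) ((c `^ p + d `^ p) `^ p^-1).
move=> A B A0 B0 AE BE BN0 AN0.
have {A0 AN0}A0 : 0 < A by rewrite lt_neqAle eq_sym AN0.
have {B0 BN0}B0 : 0 < B by rewrite lt_neqAle eq_sym BN0.
have S0 : 0 < A + B by exact: addr_gt0.
have Ap := powR_gt0 p A0; have Bp := powR_gt0 p B0; have Sp := powR_gt0 p S0.
have le1 : ((a + c) `^ p + (b + d) `^ p) / (A + B) `^ p <= 1.
  rewrite mulrDl (le_trans (lerD (powR_convex_ratio A0 B0 a0 c0)
    (powR_convex_ratio A0 B0 b0 d0)))// addrACA -!mulrDr -!mulrDl -AE -BE.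
  by rewrite !divff ?gt_eqF// !mulr1 -mulrDl divff ?gt_eqF.
move: le1; rewrite ler_pdivrMr// mul1r => leS.
have -> : A + B = ((A + B) `^ p) `^ p^-1.
  by rewrite -powRrM mulfV// powRr1// (ltW S0).
by rewrite ge0_ler_powR ?invr_ge0 ?nnegrE ?addr_ge0 ?powR_ge0 ?(ltW p_gt0).
Qed.

End real_minkowski.

(* X \oplus_p Y, as an alias of X * Y, which itself carries the max norm.  The
   proof of 1 <= p is a parameter of the type because the triangle inequality,
   hence the normedModType instance, depends on it. *)
Definition psum (R : realType) (p : R) (p1 : 1 <= p) (X Y : normedModType R) :
  Type := (X * Y)%type.

HB.instance Definition _ (R : realType) (p : R) (p1 : 1 <= p)
  (X Y : normedModType R) :=
  GRing.Lmodule.copy (psum p1 X Y) (X * Y)%type.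

Section psum_norm.
Context (R : realType) (p : R) (p1 : 1 <= p) (X Y : normedModType R).
Implicit Types x y z : psum p1 X Y.

Definition psum_norm z : R := (`|z.1| `^ p + `|z.2| `^ p) `^ p^-1.

Let p_gt0 : 0 < p. Proof. exact: lt_le_trans p1. Qed.

Let p_neq0 : p != 0. Proof. by rewrite gt_eqF. Qed.

Lemma psum_norm_ge0 z : 0 <= psum_norm z.
Proof. exact: powR_ge0. Qed.

Lemma psum_normK z : psum_norm z `^ p = `|z.1| `^ p + `|z.2| `^ p.
Proof. by rewrite -powRrM mulVf// powRr1// addr_ge0// powR_ge0. Qed.

Lemma psum_norm0_eq0 z : psum_norm z = 0 -> z = 0.
Proof.
move=> z0; have /esym/eqP := psum_normK z.
rewrite z0 powR0// paddr_eq0 ?powR_ge0//.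
case: z {z0} => a b /= /andP[/eqP/powR_eq0_eq0/eqP + /eqP/powR_eq0_eq0/eqP].
by rewrite !normr_eq0 => /eqP-> /eqP->.
Qed.

Lemma psum_normZ (l : R) z : psum_norm (l *: z) = `|l| * psum_norm z.
Proof.
rewrite /psum_norm /= !normrZ !powRM// -mulrDr powRM ?addr_ge0 ?powR_ge0//.
by rewrite -powRrM mulfV// powRr1.
Qed.

Lemma psum_normD x y : psum_norm (x + y) <= psum_norm x + psum_norm y.
Proof.
rewrite /psum_norm; apply: (le_trans _ (powR2_minkowski p1 (normr_ge0 x.1)
  (normr_ge0 x.2) (normr_ge0 y.1) (normr_ge0 y.2))).
have /= := ler_normD x.1 y.1; have /= := ler_normD x.2 y.2.
have := normr_ge0 (x.1 + y.1); have := normr_ge0 (x.2 + y.2).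
have := normr_ge0 x.1; have := normr_ge0 x.2.
have := normr_ge0 y.1; have := normr_ge0 y.2.
move: `|x.1| `|x.2| `|y.1| `|y.2| `|x.1 + y.1| `|x.2 + y.2| => a b c d u v.
move=> d0 c0 b0 a0 v0 u0 vbd uac; have p0 := ltW p_gt0.
rewrite ge0_ler_powR ?invr_ge0 ?nnegrE ?addr_ge0 ?powR_ge0//.
by apply: lerD; rewrite ge0_ler_powR ?nnegrE ?addr_ge0.
Qed.

HB.instance Definition _ := @Lmodule_isNormed.Build R (psum p1 X Y)
  psum_norm psum_normD psum_normZ psum_norm0_eq0.

End psum_norm.

Lemma psum_normE (R : realType) (p : R) (p1 : 1 <= p) (X Y : normedModType R)
    (z : psum p1 X Y) :
  `|z| = (`|z.1| `^ p + `|z.2| `^ p) `^ p^-1.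
Proof. by []. Qed.

Definition psum_set (R : realType) (p : R) (p1 : 1 <= p)
    (X Y : normedModType R) (H : set X) (N : set Y) : set (psum p1 X Y) :=
  H `*` N.
Arguments psum_set {R p} p1 {X Y} H N _.

Section M_compact.
Context (R : realType) (E : normedModType R).
Implicit Types (G : set E) (x : E) (u : E^nat).

(* [sup] is the real supremum: meaningful for nonempty bounded G only. *)
Definition far_dist x G : R := sup [set `|x - e| | e in G].

Definition maximizing_seq G u : Prop :=
  (forall n, G (u n)) /\
  exists x, `|u n - x| @[n --> \oo] --> far_dist x G.

Definition M_compact G : Prop :=
  forall u, maximizing_seq G u ->
    exists f : nat -> nat, increasing_seq f /\
      exists l, G l /\ u (f n) @[n --> \oo] --> l.

End M_compact.

(* Main.v *)
Require Import Defs.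
From mathcomp Require Import all_boot all_order all_algebra.
From mathcomp Require Import all_classical all_reals all_analysis.

Import Order.TTheory GRing.Theory Num.Theory.
Import numFieldNormedType.Exports.

Local Open Scope classical_set_scope.
Local Open Scope ring_scope.

(** Write [`|(a, b)|] for the p-norm of the plane.  The p-norm is monotone in the
    norms of the two coordinates, and the coordinates of a point of the product
    set vary independently, so the farthest distance from [c] to the product is
    the p-norm of the two farthest distances: that is [far_dist_psum].

    The heart of the matter is that a sequence of the product is maximizing for
    [c] exactly when each coordinate is maximizing for the corresponding
    coordinate of [c] ([maximizing_psumP]).  This reduces to a fact about real
    sequences, [psum_norm_cvgP]: if [u n <= a] and [v n <= b], then
    [`|(u n, v n)|] tends to [`|(a, b)|] only if [u n] tends to [a] and [v n]
    to [b], because neither coordinate can make up for what the other lacks.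

    Since norm convergence in the p-sum is coordinatewise ([cvg_psumP]), both
    implications follow.  If both factors are M-compact, extract a subsequence
    along which the first coordinate converges, then a further one for the
    second coordinate, which is still maximizing along the first extraction.
    Conversely, a maximizing sequence of one factor is completed to a maximizing
    sequence of the product by any maximizing sequence of the other factor, and
    one always exists ([maximizing_seq_exists]). *)

Set Implicit Arguments.
Unset Strict Implicit.
Unset Printing Implicit Defensive.

(** * Subsequences *)

Lemma increasing_seq_cvgn (f : nat -> nat) :
  increasing_seq f -> f @ \oo --> \oo.
Proof.
move=> f_inc; have f_ge n : (n <= f n)%N.
  elim: n => // n IHn; apply: leq_ltn_trans IHn _.
  by move/increasing_seqP : f_inc; apply.
move=> A [m _ mA]; exists m => // n /= mn; apply: mA => /=.
exact: leq_trans mn (f_ge n).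
Qed.

Lemma cvgn_subseq (T : topologicalType) (u : T^nat) (l : T) (f : nat -> nat) :
  increasing_seq f -> u n @[n --> \oo] --> l -> u (f n) @[n --> \oo] --> l.
Proof. by move=> /increasing_seq_cvgn f_oo ul; apply: cvg_comp f_oo ul. Qed.

(** * Norm and convergence in the p-sum *)

Section psum_topology.
Context (R : realType) (p : R) (p1 : 1 <= p) (X Y : normedModType R).
Implicit Types z l : psum p1 X Y.

Let p_gt0 : 0 < p. Proof. exact: lt_le_trans p1. Qed.

Let p_neq0 : p != 0. Proof. by rewrite gt_eqF. Qed.

Lemma psum_norm_fst (x : X) : `|(x, 0) : psum p1 X Y| = `|x|.
Proof.
by rewrite psum_normE /= normr0 powR0// addr0 -powRrM mulfV// powRr1.
Qed.

Lemma psum_norm_snd (y : Y) : `|(0, y) : psum p1 X Y| = `|y|.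
Proof.
by rewrite psum_normE /= normr0 powR0// add0r -powRrM mulfV// powRr1.
Qed.

Lemma ler_psum_norm z1 z2 :
  `|z1.1| <= `|z2.1| -> `|z1.2| <= `|z2.2| -> `|z1| <= `|z2|.
Proof.
move=> le1 le2; rewrite !psum_normE; apply: ge0_ler_powR;
  rewrite ?invr_ge0 ?nnegrE ?addr_ge0 ?powR_ge0 ?(ltW p_gt0)//.
by apply: lerD; apply: ge0_ler_powR; rewrite ?nnegrE ?(ltW p_gt0).
Qed.

Lemma psum_norm_ge_fst z : `|z.1| <= `|z|.
Proof.
by rewrite -psum_norm_fst; apply: ler_psum_norm => //=; rewrite normr0.
Qed.

Lemma psum_norm_ge_snd z : `|z.2| <= `|z|.
Proof.
by rewrite -psum_norm_snd; apply: ler_psum_norm => //=; rewrite normr0.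
Qed.

(** The p-norm is below the 1-norm: apply the triangle inequality to
    [(x, y) = (x, 0) + (0, y)]. *)
Lemma psum_norm_le_add z : `|z| <= `|z.1| + `|z.2|.
Proof.
have -> : z = ((z.1, 0) : psum p1 X Y) + ((0, z.2) : psum p1 X Y).
  by case: z => x y; congr (_, _) => /=; rewrite ?addr0 ?add0r.
apply: le_trans (ler_normD _ _) _.
by rewrite psum_norm_fst psum_norm_snd /= addr0 add0r.
Qed.

(** The p-norm lies between the max norm and the 1-norm, whose convergent
    sequences are the coordinatewise convergent ones. *)
Lemma cvg_psumP (w : (psum p1 X Y)^nat) l :
  w n @[n --> \oo] --> l <->
  (w n).1 @[n --> \oo] --> l.1 /\ (w n).2 @[n --> \oo] --> l.2.
Proof.
split=> [/cvgrPdist_lt wl | [/cvgrPdist_lt w1 /cvgrPdist_lt w2]].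
  split; apply/cvgrPdist_lt => e e0; apply: filterS (wl e e0) => n.
    exact: le_lt_trans (psum_norm_ge_fst (l - w n)).
  exact: le_lt_trans (psum_norm_ge_snd (l - w n)).
apply/cvgrPdist_lt => e e0; have e20 : 0 < e / 2 by rewrite divr_gt0.
apply: filterS2 (w1 _ e20) (w2 _ e20) => n le1 le2.
apply: le_lt_trans (psum_norm_le_add _) _.
by rewrite [e]splitr; exact: ltrD.
Qed.

End psum_topology.

(** * The p-norm of the plane *)

Section plane.
Context (R : realType) (p : R) (p1 : 1 <= p).

Let p_gt0 : 0 < p. Proof. exact: lt_le_trans p1. Qed.

(** Transfers distances in an arbitrary p-sum to the real plane, where the
    convergence of distances can be studied coordinatewise. *)
Lemma psum_norm_dist (X Y : normedModType R) (z c : psum p1 X Y) :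
  `|z - c| = `|(`|z.1 - c.1|, `|z.2 - c.2|) : psum p1 R^o R^o|.
Proof. by rewrite !psum_normE /= !normr_id. Qed.

(** The p-th power of the comparison of the p-norm with the 1-norm. *)
Lemma powR_superadditive (a b : R) : 0 <= a -> 0 <= b ->
  a `^ p + b `^ p <= (a + b) `^ p.
Proof.
move=> a0 b0; have ab0 : 0 <= a + b by exact: addr_ge0.
have := @psum_norm_le_add R p p1 R^o R^o (a, b).
rewrite /= (ger0_norm a0) (ger0_norm b0) => le_ab.
have := @psum_normK R p p1 R^o R^o (a, b).
rewrite /= (ger0_norm a0) (ger0_norm b0) => <-.
by apply: ge0_ler_powR; rewrite ?nnegrE ?psum_norm_ge0 ?(ltW p_gt0).
Qed.

(** If [e <= a - u n], then superadditivity gives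
    [u n `^ p <= a `^ p - e `^ p], so that the p-norm of [(u n, v n)] is at most
    the constant [s := (a `^ p + b `^ p - e `^ p) `^ p^-1], which is less than
    the limit; this can therefore happen for finitely many [n] only.  Comparing
    with [s] replaces any appeal to the continuity of powers at 0. *)
Lemma powR_root_cvg_fst (a b : R) (u v : R^nat) :
  (forall n, 0 <= u n <= a) -> (forall n, 0 <= v n <= b) ->
  (u n `^ p + v n `^ p) `^ p^-1 @[n --> \oo] --> (a `^ p + b `^ p) `^ p^-1 ->
  u n @[n --> \oo] --> a.
Proof.
move=> ua vb /cvgr_gt uv_gt; apply/cvgrPdist_lt => e e0.
(* When [a < e] the bound is trivial; otherwise [e <= a] makes the base of the
   power defining [s] nonnegative. *)
have [ae|ea] := ltP a e.
  apply: nearW => n; have /andP[u0 une] := ua n.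
  by rewrite ger0_norm ?subr_ge0// (le_lt_trans _ ae)// lerBlDr lerDl.
have ep0 : 0 < e `^ p by exact: powR_gt0.
have eap : e `^ p <= a `^ p.
  apply: ge0_ler_powR; rewrite ?nnegrE ?(ltW p_gt0) ?(ltW e0)//.
  exact: le_trans (ltW e0) ea.
have sp0 : 0 <= a `^ p + b `^ p - e `^ p.
  by rewrite addrAC addr_ge0 ?powR_ge0 ?subr_ge0.
have ab0 : 0 <= a `^ p + b `^ p by rewrite addr_ge0 ?powR_ge0.
pose s := (a `^ p + b `^ p - e `^ p) `^ p^-1.
have s_lt : s < (a `^ p + b `^ p) `^ p^-1.
  by apply: gt0_ltr_powR; rewrite ?invr_gt0 ?nnegrE// ltrBlDr ltrDl.
apply: filterS (uv_gt s s_lt) => n /=; apply: contraTT.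
have /andP[u0 una] := ua n; have /andP[v0 vnb] := vb n.
rewrite ger0_norm ?subr_ge0// -!leNgt => e_le.
apply: ge0_ler_powR; rewrite ?invr_ge0 ?nnegrE ?(ltW p_gt0)//.
  by rewrite addr_ge0 ?powR_ge0.
have vbp : v n `^ p <= b `^ p.
  by apply: ge0_ler_powR; rewrite ?nnegrE ?(ltW p_gt0)// (le_trans v0).
rewrite lerBrDr addrAC lerD// addrC.
have /le_trans : e `^ p + u n `^ p <= (e + u n) `^ p.
  by apply: powR_superadditive => //; exact: ltW.
have eu0 : 0 <= e + u n by rewrite addr_ge0 ?(ltW e0).
have eua : e + u n <= a by rewrite -lerBrDr.
by apply; apply: ge0_ler_powR; rewrite ?nnegrE ?(ltW p_gt0)// (le_trans u0).
Qed.

(** From right to left this is the continuity of the norm of the p-sum of two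
    real lines. *)
Lemma psum_norm_cvgP (a b : R) (u v : R^nat) :
  (forall n, 0 <= u n <= a) -> (forall n, 0 <= v n <= b) ->
  `|(u n, v n) : psum p1 R^o R^o| @[n --> \oo] -->
    `|(a, b) : psum p1 R^o R^o| <->
  u n @[n --> \oo] --> a /\ v n @[n --> \oo] --> b.
Proof.
move=> ua vb; split=> [|[ul vl]]; last first.
  apply: cvg_norm.
  by apply/(@cvg_psumP R p p1 R^o R^o (fun n => (u n, v n)) (a, b)).
have [a0 b0] : 0 <= a /\ 0 <= b.
  have /andP[/le_trans le_u /le_u a0] := ua 0%N.
  by have /andP[/le_trans le_v /le_v] := vb 0%N.
have -> : `|(a, b) : psum p1 R^o R^o| = (a `^ p + b `^ p) `^ p^-1.
  by rewrite psum_normE /= !ger0_norm.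
under eq_fun => n.
  have /andP[u0 _] := ua n; have /andP[v0 _] := vb n.
  rewrite psum_normE /= (ger0_norm u0) (ger0_norm v0); over.
move=> uv; split; first exact: powR_root_cvg_fst ua vb uv.
apply: powR_root_cvg_fst vb ua _; rewrite (addrC (b `^ p)).
by under eq_fun do rewrite addrC.
Qed.

End plane.

(** * Farthest distances and maximizing sequences *)

Section far_dist.
Context (R : realType) (E : normedModType R) (G : set E) (x : E).
Hypotheses (G0 : G !=set0) (Gb : bounded_set G).

Lemma has_sup_dist : has_sup [set `|x - e| | e in G].
Proof.
split; first by case: G0 => g Gg; exists `|x - g|, g.
have [M [_ GM]] := Gb; exists (`|x| + (M + 1)) => _ [g Gg <-].
apply: le_trans (ler_normB _ _) _; rewrite lerD2l.
by apply: GM Gg; rewrite ltrDl.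
Qed.

Lemma le_far_dist g : G g -> `|g - x| <= far_dist x G.
Proof.
move=> Gg; apply: ub_le_sup; first by case: has_sup_dist.
by exists g; rewrite // distrC.
Qed.

Lemma maximizing_seq_exists :
  exists2 u : E^nat, forall n, G (u n) &
    `|u n - x| @[n --> \oo] --> far_dist x G.
Proof.
have near_sup n : exists g, G g /\ far_dist x G - n.+1%:R^-1 < `|g - x|.
  have n0 : 0 < n.+1%:R^-1 :> R by rewrite invr_gt0.
  have [_ [g Gg <-] lt_g] := sup_adherent n0 has_sup_dist.
  by exists g; split; rewrite // distrC.
have [u uP] := choice near_sup; exists u => [n|]; first by case: (uP n).
have lower_cvg : far_dist x G - n.+1%:R^-1 @[n --> \oo] --> far_dist x G.
  rewrite -[X in _ --> X]subr0.
  by apply: cvgB; [exact: cvg_cst | exact: cvg_harmonic].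
apply: (squeeze_cvgr _ lower_cvg (cvg_cst _)).
apply: nearW => n; have [Gu /ltW ->] := uP n; exact: le_far_dist.
Qed.

End far_dist.

Section maximizing_product.
Context (R : realType) (X Y : normedModType R) (p : R) (p1 : 1 <= p).
Context (H : set X) (N : set Y).
Hypotheses (H0 : H !=set0) (Hb : bounded_set H).
Hypotheses (N0 : N !=set0) (Nb : bounded_set N).

Let dist_itv (E : normedModType R) (G : set E) (x : E) (u : E^nat) :
  G !=set0 -> bounded_set G -> (forall n, G (u n)) ->
  forall n, 0 <= `|u n - x| <= far_dist x G.
Proof. by move=> G0 Gb Gu n; rewrite normr_ge0 le_far_dist. Qed.

Lemma psum_set_nonempty : psum_set p1 H N !=set0.
Proof. by have [[h Hh] [n Nn]] := (H0, N0); exists (h, n). Qed.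

Lemma psum_set_bounded : bounded_set (psum_set p1 H N).
Proof.
have [A [Ar HA]] := Hb; have [B [Br NB]] := Nb.
exists (A + 1 + (B + 1)); split; first exact: num_real.
move=> M ltM z [Hz Nz]; apply: le_trans (psum_norm_le_add _) _.
apply: le_trans (ltW ltM); apply: lerD; first by apply: HA Hz; rewrite ltrDl.
by apply: NB Nz; rewrite ltrDl.
Qed.

(** The p-norm of the two suprema is an upper bound by monotonicity.  It is
    approached along pairs of coordinatewise maximizing sequences, so it cannot
    exceed the supremum over the product. *)
Lemma far_dist_psum (c : psum p1 X Y) :
  far_dist c (psum_set p1 H N) =
  `|(far_dist c.1 H, far_dist c.2 N) : psum p1 R^o R^o|.
Proof.
have [u Hu u_cvg] := @maximizing_seq_exists R X H c.1 H0 Hb.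
have [v Nv v_cvg] := @maximizing_seq_exists R Y N c.2 N0 Nb.
apply/eqP; rewrite eq_le; apply/andP; split.
  apply: ge_sup.
    by have [z Gz] := psum_set_nonempty; exists `|c - z|, z.
  move=> _ [z [Hz Nz] <-]; rewrite distrC psum_norm_dist.
  apply: ler_psum_norm;
    by rewrite /= normr_id (le_trans _ (ler_norm _))// le_far_dist.
have uv_cvg : `|(`|u n - c.1|, `|v n - c.2|) : psum p1 R^o R^o| @[n --> \oo] -->
    `|(far_dist c.1 H, far_dist c.2 N) : psum p1 R^o R^o|.
  by apply/psum_norm_cvgP; [exact: dist_itv | exact: dist_itv | split].
apply: (cvgr_to_le uv_cvg); apply: nearW => n.
rewrite -(@psum_norm_dist R p p1 X Y (u n, v n) c); apply: le_far_dist.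
- exact: psum_set_nonempty.
- exact: psum_set_bounded.
- by split; [exact: Hu | exact: Nv].
Qed.

Lemma maximizing_psumP (w : (psum p1 X Y)^nat) (c : psum p1 X Y) :
  (forall n, psum_set p1 H N (w n)) ->
  `|w n - c| @[n --> \oo] --> far_dist c (psum_set p1 H N) <->
  `|(w n).1 - c.1| @[n --> \oo] --> far_dist c.1 H /\
  `|(w n).2 - c.2| @[n --> \oo] --> far_dist c.2 N.
Proof.
move=> Gw; have Hw n : H (w n).1 by case: (Gw n).
have Nw n : N (w n).2 by case: (Gw n).
rewrite far_dist_psum; under eq_fun do rewrite psum_norm_dist.
by apply: psum_norm_cvgP; exact: dist_itv.
Qed.

End maximizing_product.

(** * M-compactness of the product *)

Theorem proposition2p3 (R : realType) (X Y : normedModType R) (p : R)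
    (p1 : 1 <= p) (H : set X) (N : set Y) :
  H !=set0 -> bounded_set H -> N !=set0 -> bounded_set N ->
  (M_compact H /\ M_compact N) <-> M_compact (psum_set p1 H N).
Proof.
move=> H0 Hb N0 Nb; split=> [[MH MN] w [Gw [c w_max]] | MG].
  have Hw n : H (w n).1 by case: (Gw n).
  have Nw n : N (w n).2 by case: (Gw n).
  have [max1 max2] := (maximizing_psumP H0 Hb N0 Nb c Gw).1 w_max.
  have maxH : maximizing_seq H (fun n => (w n).1) by split=> //; exists c.1.
  have [f [f_inc [x [Hx w1_x]]]] := MH _ maxH.
  have maxN : maximizing_seq N (fun n => (w (f n)).2).
    by split=> [n //|]; exists c.2; exact: cvgn_subseq max2.
  have [g [g_inc [y [Ny w2_y]]]] := MN _ maxN.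
  exists (f \o g); split.
    by move=> m n; exact: etrans (f_inc _ _) (g_inc m n).
  exists (x, y); split; first by [].
  by apply/cvg_psumP; split; [exact: cvgn_subseq w1_x | ].
split=> [u [Hu [x u_max]] | v [Nv [y v_max]]].
(* The complementary coordinate maximizes the distance to an arbitrary point,
   here 0. *)
- have [v Nv v_max] := @maximizing_seq_exists R Y N 0 N0 Nb.
  pose w n : psum p1 X Y := (u n, v n).
  have Gw n : psum_set p1 H N (w n) by split; [exact: Hu | exact: Nv].
  have w_max : maximizing_seq (psum_set p1 H N) w.
    by split=> //; exists (x, 0); apply/maximizing_psumP.
  have [f [f_inc [l [[Hl _] /cvg_psumP[u_l _]]]]] := MG _ w_max.
  by exists f; split=> //; exists l.1.
- have [u Hu u_max] := @maximizing_seq_exists R X H 0 H0 Hb.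
  pose w n : psum p1 X Y := (u n, v n).
  have Gw n : psum_set p1 H N (w n) by split; [exact: Hu | exact: Nv].
  have w_max : maximizing_seq (psum_set p1 H N) w.
    by split=> //; exists (0, y); apply/maximizing_psumP.
  have [f [f_inc [l [[_ Nl] /cvg_psumP[_ v_l]]]]] := MG _ w_max.
  by exists f; split=> //; exists l.2.
Qed.
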